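(* Let $d\geq 3$ be an integer and let $q$ be a prime power. For $\alpha\in\mathbb{F}_q$, let $C_\alpha\subset\mathbb{P}^2$ be the plane curve over $\mathbb{F}_q$ given by $yz^{d-1}=x^d-\alpha z^d$. There exists a subset $S\subseteq\mathbb{F}_q$ of size at most $$1+\left\lfloor\frac{2\log q}{\log\left(\frac{d}{d-1}\right)}\right\rfloor$$ with the property that $$U:=\bigcup_{\alpha\in S}C_\alpha(\mathbb{F}_q)$$ is a blocking set in $\mathbb{P}^2(\mathbb{F}_q)$.
   Context: A set $B\subseteq\mathbb{P}^2(\mathbb{F}_q)$ is a blocking set if it intersects every $\mathbb{F}_q$-line of $\mathbb{P}^2$ (i.e. every line $ax+by+cz=0$ with $[a:b:c]\in\mathbb{P}^2(\mathbb{F}_q)$). *)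

(* Defs.v *)
From HB Require Import structures.
From mathcomp Require Import all_boot all_order all_algebra.

Set Implicit Arguments.
Unset Strict Implicit.
Unset Printing Implicit Defensive.

Import GRing.Theory.

Local Open Scope ring_scope.
Local Open Scope quotient_scope.

Section ProjectivePlane.
Variable F : finFieldType.

Definition nzvec : predArgType := {v : 'rV[F]_3 | v != 0}.

Definition proportional : rel nzvec :=
  fun u v => [exists a : F, (a != 0) && (val u == a *: val v)].

Lemma proportional_refl : reflexive proportional.
Proof. by move=> u; apply/existsP; exists 1; rewrite oner_neq0 scale1r eqxx. Qed.

Lemma proportional_sym : symmetric proportional.
Proof.
have H u v : proportional u v -> proportional v u.
  case/existsP=> a /andP[a0 /eqP uv]; apply/existsP; exists a^-1.
  by rewrite invr_eq0 a0 uv scalerA mulVf // scale1r eqxx.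
by move=> u v; apply/idP/idP; apply: H.
Qed.

Lemma proportional_trans : transitive proportional.
Proof.
move=> v u w /existsP[a /andP[a0 /eqP uv]] /existsP[b /andP[b0 /eqP vw]].
apply/existsP; exists (a * b).
by rewrite mulf_neq0 //= uv vw scalerA.
Qed.

Canonical proportional_equiv :=
  EquivRel proportional proportional_refl proportional_sym proportional_trans.

Definition P2 : predArgType := {eq_quot proportional}.

HB.instance Definition _ := EqQuotient.on P2.
HB.instance Definition _ := Choice.on P2.
HB.instance Definition _ : isCountable P2 := CanIsCountable (@reprK _ P2).
HB.instance Definition _ : isFinite P2 := CanIsFinite (@reprK _ P2).

(* Homogeneous coordinates of a chosen representative of P; see mem_line and
   mem_curve for the independence of this choice. *)
Definition hcoord (P : P2) : 'rV[F]_3 := val (repr P).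

Notation X v := (v 0 0).
Notation Y v := (v 0 1).
Notation Z v := (v 0 2).

Definition on_line (l v : 'rV[F]_3) : bool :=
  X l * X v + Y l * Y v + Z l * Z v == 0.

Definition on_curve (d : nat) (alpha : F) (v : 'rV[F]_3) : bool :=
  Y v * Z v ^+ d.-1 == X v ^+ d - alpha * Z v ^+ d.

(* A line ax + by + cz = 0 is given by its coefficients [a : b : c]. *)
Definition line (l : P2) : {set P2} :=
  [set P | on_line (hcoord l) (hcoord P)].

(* The set of F-points of the curve y z^(d-1) = x^d - alpha z^d. *)
Definition curve (d : nat) (alpha : F) : {set P2} :=
  [set P | on_curve d alpha (hcoord P)].

Definition blocking_set (B : {set P2}) : Prop :=
  forall l : P2, exists2 P, P \in B & P \in line l.

Lemma hcoord_pi (v : nzvec) :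
  exists2 a : F, a != 0 & hcoord (\pi_P2 v) = a *: val v.
Proof.
have : repr (\pi_P2 v) = v %[mod P2] by rewrite reprK.
by move/eqmodP/existsP=> [a /andP[a0 /eqP e]]; exists a.
Qed.

Lemma on_lineZ (a b : F) (l v : 'rV[F]_3) : a != 0 -> b != 0 ->
  on_line (a *: l) (b *: v) = on_line l v.
Proof.
move=> a0 b0; have ab0 : a * b != 0 by rewrite mulf_neq0.
rewrite /on_line !mxE.
move: (X l) (Y l) (Z l) (X v) (Y v) (Z v) => l0 l1 l2 v0 v1 v2.
rewrite (mulrACA a l0) (mulrACA a l1) (mulrACA a l2) -!mulrDr.
by rewrite mulf_eq0 (negbTE ab0).
Qed.

Lemma on_curveZ (d : nat) (alpha b : F) (v : 'rV[F]_3) : (0 < d)%N -> b != 0 ->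
  on_curve d alpha (b *: v) = on_curve d alpha v.
Proof.
case: d => // d _ b0; have bd0 : b ^+ d.+1 != 0 by rewrite expf_neq0.
rewrite /on_curve !mxE.
move: (X v) (Y v) (Z v) => v0 v1 v2 /=.
rewrite !exprMn (mulrACA b v1) -exprS (mulrCA alpha) -mulrBr.
by rewrite (inj_eq (mulfI bd0)).
Qed.

Lemma mem_line (l v : nzvec) :
  (\pi_P2 v \in line (\pi_P2 l)) = on_line (val l) (val v).
Proof.
rewrite in_set; have [a a0 ->] := hcoord_pi l.
by have [b b0 ->] := hcoord_pi v; exact: on_lineZ.
Qed.

Lemma mem_curve (d : nat) (alpha : F) (v : nzvec) : (0 < d)%N ->
  (\pi_P2 v \in curve d alpha) = on_curve d alpha (val v).
Proof.
move=> d0; rewrite in_set; have [b b0 ->] := hcoord_pi v.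
exact: on_curveZ.
Qed.

End ProjectivePlane.

(* Main.v *)
Require Import Defs.
From mathcomp Require Import all_boot all_order all_algebra.
From mathcomp Require Import reals exp.
From mathcomp Require Import ring.

(* All C_alpha pass through [0:1:0], so only the q^2 lines not through that
   point matter.  Such a line y = - u x - v meets C_alpha as soon as
   alpha lies in the value set of x^d + u x + v, which has at least q / d
   elements.  By averaging, some alpha therefore serves at least a proportion
   1 / d of any given set of lines; choosing such an alpha greedily k times
   leaves at most q^2 ((d - 1) / d)^k lines, which is less than 1 as soon as
   k > 2 log q / log (d / (d - 1)). *)

Import Order.TTheory GRing.Theory Num.Theory.

Local Open Scope ring_scope.

(** Double counting: at least [#|A| * #|X| / d] pairs [(t, a)] have [t] in [X] and [a] in [r t], so
    an average [a] lies in [r t] for a proportion [1 / d] of [X]. *)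
Lemma exists_popular_element (T A : finType) (r : T -> {set A}) (d : nat)
    (X : {set T}) : (0 < #|A|)%N -> (forall t, #|A| <= d * #|r t|)%N ->
  exists a, (#|X| <= d * #|[set t in X | a \in r t]|)%N.
Proof.
move=> A0 rA; apply/existsP; apply: contraT; rewrite negb_exists => /forallP H.
have dc : (\sum_(a : A) #|[set t in X | a \in r t]| = \sum_(t in X) #|r t|)%N.
  transitivity (\sum_(a : A) \sum_(t in X) (a \in r t : nat))%N.
    apply: eq_bigr => a _; rewrite -sum1dep_card big_mkcondr.
    by apply: eq_bigr => t _; case: (a \in r t).
  rewrite exchange_big; apply: eq_bigr => t _.
  rewrite -sum1_card [RHS]big_mkcond.
  by apply: eq_bigr => a _; case: (a \in r t).
have le1 : (#|A| * #|X| <= d * \sum_(a : A) #|[set t in X | a \in r t]|)%N.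
  by rewrite dc big_distrr mulnC -sum_nat_const; apply: leq_sum.
(* If every [a] fails, integrality gains 1 for each [a]; these add up to [#|A| > 0] and contradict
   [le1]. *)
have lt1 : (\sum_(a : A) (d * #|[set t in X | a \in r t]|).+1
            <= \sum_(a : A) #|X|)%N.
  by apply: leq_sum => a _; rewrite ltnNge H.
move: lt1; under eq_bigr do rewrite -addn1.
rewrite big_split -big_distrr /= sum1_card sum_nat_const => lt1.
by move: (leq_trans lt1 le1); rewrite -leq_subRL // subnn leqNgt A0.
Qed.

(** Each step adds an element popular among the sets still missed, which leaves at most a proportion
    [(d - 1) / d] of them. Powers of [d] are cleared to stay in [nat]. *)
Lemma greedy_hitting_set (T A : finType) (r : T -> {set A}) (d k : nat) :
  (0 < #|A|)%N -> (forall t, #|A| <= d * #|r t|)%N ->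
  exists2 S : {set A}, (#|S| <= k)%N &
    (d ^ k * #|[set t | [disjoint r t & S]]| <= d.-1 ^ k * #|T|)%N.
Proof.
move=> A0 rA; elim: k => [|k [S Sk leS]].
  by exists set0; rewrite ?cards0 // !mul1n max_card.
have [a] := exists_popular_element _ _ r d [set t | [disjoint r t & S]] A0 rA.
set X := [set t | _] => leX; exists (a |: S).
  by rewrite cardsU1 -add1n leq_add // leq_b1.
have -> : [set t | [disjoint r t & a |: S]] = X :\: [set t in X | a \in r t].
  apply/setP=> t; rewrite !inE -!setI_eq0 setIUr setU_eq0 !setI_eq0.
  rewrite disjoint_sym disjoints1.
  by case: (a \in r t); rewrite ?(andbT, andbF) /= ?andNb.
rewrite cardsDS ?subsetIl //; last first.
  by apply/subsetP => t; rewrite inE => /andP[].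
apply: (@leq_trans (d.-1 * (d ^ k * #|X|))); last first.
  by rewrite expnS -mulnA leq_mul2l leS orbT.
(* With the factor [d ^ k] removed, [d * (#|X| - h) <= (d - 1) * #|X|] is [leX], where [h] counts
   the newly hit indices. *)
rewrite expnS mulnAC mulnBr mulnC mulnCA leq_mul2l.
by rewrite -subn1 mulnBl mul1n leq_sub2l ?orbT.
Qed.

Lemma card_le_fibers (A B : finType) (f : A -> B) (d : nat) :
  (forall b, #|[set a | f a == b]| <= d)%N -> (#|A| <= d * #|f @: setT|)%N.
Proof.
move=> H; rewrite -cardsT -sum1_card (partition_big_imset f) /=.
rewrite mulnC -sum_nat_const; apply: leq_sum => b _.
by under eq_bigl do rewrite inE /=; rewrite sum1dep_card.
Qed.

(** The one [alpha] whose curve passes through the point of abscissa [x] on the line y = - u x - v,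
    where [t = (u, v)]. *)
Definition line_value {F : finFieldType} (d : nat) (t : F * F) (x : F) : F :=
  x ^+ d + t.1 * x + t.2.

Lemma card_line_value_fiber (F : finFieldType) (d : nat) (t : F * F) (b : F) :
  (1 < d)%N -> (#|[set x | line_value d t x == b]| <= d)%N.
Proof.
move=> d1; pose p : {poly F} := 'X^d + (t.1 *: 'X + (t.2 - b)%:P).
(* As [1 < d], the affine part cannot disturb the leading term ['X^d]. *)
have sp : size p = d.+1.
  rewrite size_polyDl size_polyXn // ltnS.
  apply: leq_trans (size_polyD _ _) _; rewrite geq_max.
  rewrite (leq_trans (size_scale_leq _ _)) ?size_polyX //=.
  exact: leq_trans (size_polyC_leq1 _) (ltnW d1).
have p0 : p != 0 by rewrite -size_poly_eq0 sp.
rewrite cardE -ltnS -sp; apply: max_poly_roots (enum_uniq _) => //.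
apply/allP => x; rewrite mem_enum inE -subr_eq0.
rewrite /root /p /line_value.
by rewrite !(hornerD, hornerXn, hornerZ, hornerX, hornerC) !addrA.
Qed.

Definition point {F : finFieldType} (x y z : F) : 'rV[F]_3 :=
  \row_i [:: x; y; z]`_i.

Lemma blocking_set_curves (F : finFieldType) (d : nat) (S : {set F}) :
  (1 < d)%N -> S != set0 -> (forall t, exists x, line_value d t x \in S) ->
  blocking_set (\bigcup_(alpha in S) curve d alpha).
Proof.
move=> d1 /set0Pn[alpha Salpha] HS; elim/quotW => l.
have d0 := ltnW d1.
suff [a aS [v v0 /andP[vc vl]]] : exists2 a, a \in S & exists2 v : 'rV[F]_3,
    v != 0 & on_curve d a v && on_line (val l) v.
  exists (\pi_(P2 F) (Sub v v0 : nzvec F))%qT; last by rewrite mem_line SubK.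
  by apply/bigcupP; exists a => //; rewrite mem_curve // SubK.
set a := val l 0 0; set b := val l 0 1; set c := val l 0 2.
have [b0|b0] := eqVneq b 0.
  (* The line passes through [0:1:0], which is on every curve because both [d] and [d - 1] are
     positive; any member of [S] will do. *)
  exists alpha => //; exists (point 0 1 0).
    by apply/eqP=> /rowP/(_ 1)/eqP; rewrite !mxE oner_eq0.
  rewrite /on_curve /on_line -/a -/b -/c b0 !mxE /= !expr0n.
  by case: d d1 {HS d0} => [|[|n]] //= _; rewrite !mulr0 mul0r subrr !addr0 !eqxx.
(* Divided by [b], the line becomes y = - (a / b) x - c / b in the chart z = 1. *)
have [x xS] := HS (a / b, c / b).
exists (line_value d (a / b, c / b) x) => //.
exists (point x (- (a / b * x + c / b)) 1).
  by apply/eqP=> /rowP/(_ 2)/eqP; rewrite !mxE oner_eq0.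
rewrite /on_curve /on_line -/a -/b -/c !mxE /= !expr1n /line_value /=.
by apply/andP; split; apply/eqP; [ring | field].
Qed.

Lemma greedy_steps (R : realType) (d q : nat) : (1 < d)%N -> (0 < q)%N ->
  exists2 k : nat,
    k%:Z = 1 + Num.floor (2 * ln (q%:R : R) / ln (d%:R / (d%:R - 1) : R)) &
    (d.-1 ^ k * q ^ 2 < d ^ k)%N.
Proof.
case: d => [|[|n]] // _ q0.
rewrite -[n.+2%:R]natr1 addrK natr1.
have n0 : 0 < n.+1%:R :> R by rewrite ltr0n.
have ratio1 : 1 < n.+2%:R / n.+1%:R :> R by rewrite ltr_pdivlMr // mul1r ltr_nat.
have ln0 := ln_gt0 ratio1.
set x := 2 * _ / _.
have x0 : 0 <= x by rewrite divr_ge0 ?(ltW ln0) // mulr_ge0 // ln_ge0 // ler1n.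
have [k kE] : exists k : nat, k%:Z = 1 + Num.floor x.
  by exists (1 + `|Num.floor x|)%N; rewrite PoszD gez0_abs // floor_ge0.
exists k => //.
(* The 1 added to the floor makes this strict even when [x] is an integer; exponentiating then gives
   q^2 < (d / (d - 1))^k. *)
have xk : x < k%:R by have := floorD1_gt x; rewrite addrC -kE.
have : ln (q%:R ^+ 2) < ln ((n.+2%:R / n.+1%:R) ^+ k) :> R.
  rewrite !lnXn ?ltr0n ?divr_gt0 // -[ltRHS]mulr_natl -ltr_pdivrMr //.
  by rewrite -[ln _ *+ 2]mulr_natl.
rewrite ltr_ln ?posrE ?exprn_gt0 ?divr_gt0 ?ltr0n //.
by rewrite expr_div_n ltr_pdivlMr ?exprn_gt0 // -!natrX -natrM ltr_nat mulnC.
Qed.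

Theorem theorem5p1 (R : realType) (d q : nat) (hd : (3 <= d)%N)
    (F : finFieldType) (hq : #|F| = q) :
  exists S : {set F},
    (#|S|%:Z <= 1 + Num.floor (2 * ln (q%:R : R) / ln (d%:R / (d%:R - 1) : R)))
    /\ blocking_set (\bigcup_(alpha in S) curve d alpha).
Proof.
have d1 : (1 < d)%N by exact: ltnW.
have F0 : (0 < #|F|)%N by apply/card_gt0P; exists 0.
rewrite -hq; have [k <- kq] := greedy_steps R _ _ d1 F0.
have [|S Sk] := greedy_hitting_set _ _
  (fun t : F * F => line_value d t @: setT) d k F0.
  by move=> t; apply: card_le_fibers => b; apply: card_line_value_fiber.
(* The number of missed pairs [t], multiplied by [d ^ k], is below [d ^ k], hence it is 0. *)
rewrite card_prod mulnn => /leq_ltn_trans/(_ kq).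
rewrite -[ltnRHS]muln1 ltn_pmul2l ?expn_gt0 ?(ltnW d1) // ltnS leqn0 cards_eq0.
move=> /eqP/setP S0.
have HS t : exists x, line_value d t x \in S.
  have := S0 t; rewrite !inE => /negbT/pred0Pn[_ /andP[/imsetP[x _ ->] xS]].
  by exists x.
exists S; split; first by rewrite lez_nat.
apply: blocking_set_curves => //.
by have [x xS] := HS (0, 0); apply/set0Pn; exists (line_value d (0, 0) x).
Qed.
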